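(* There is a Woronowicz algebra isomorphism $C(\mathcal{Q}_4)\simeq C(SO_{-1}(3))$, i.e. a $C^*$-algebra isomorphism that intertwines the comultiplications.
   Context: A matrix $u$ over a $C^*$-algebra is orthogonal if its entries are self-adjoint and $uu^t=u^tu=1$. It is a magic unitary if all its entries are projections, distinct entries on the same row or the same column are orthogonal, and the sums over each row and each column equal $1$. $C(\mathcal{Q}_4)=A_s(4)$ is the universal $C^*$-algebra generated by $(u_{ij})_{1\le i,j\le4}$ with the relations making $u=(u_{ij})$ a magic unitary, with comultiplication $\Delta(u_{ij})=\sum_k u_{ik}\otimes u_{kj}$. $C(SO_{-1}(3))$ is the universal $C^*$-algebra generated by $(a_{ij})_{1\le i,j\le3}$ with the relations: (1) $a=(a_{ij})$ is orthogonal; (2) $a_{ij}a_{ik}=-a_{ik}a_{ij}$ and $a_{ji}a_{ki}=-a_{ki}a_{ji}$ for $j\neq k$; (3) $a_{ij}a_{kl}=a_{kl}a_{ij}$ for $i\ne k$ and $j\neq l$; (4) $\sum_{s\in S_3}a_{1s(1)}a_{2s(2)}a_{3s(3)}=1$; its comultiplication is $\Delta(a_{ij})=\sum_k a_{ik}\otimes a_{kj}$. A Woronowicz algebra is a unital $C^*$-algebra $A$ with a coassociative unital $*$-morphism $\Delta:A\to A\otimes A$ (minimal tensor product) such that $\Delta(A)(A\otimes1)$ and $\Delta(A)(1\otimes A)$ are dense in $A\otimes A$. *)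

(* Defs.v *)
From HB Require Import structures.
From mathcomp Require Import all_boot all_order all_algebra all_fingroup.
From mathcomp Require Import complex.
From mathcomp Require Import all_classical all_reals all_analysis.

Set Implicit Arguments.
Unset Strict Implicit.
Unset Printing Implicit Defensive.

Import Order.TTheory GRing.Theory Num.Theory.
Import numFieldNormedType.Exports.

Local Open Scope classical_set_scope.
Local Open Scope ring_scope.

(** Unital C*-algebras over the complex numbers [R[i]]. They are packed over a
    complete normed module, since Hierarchy Builder rejects a structure
    extending both normed modules and rings that does not also lie below
    [numDomainType]. As in every [algType], [1 != 0]: the zero algebra is left
    out. The norm takes its values in the nonnegative reals of [R[i]]. *)
Record cstarType (R : realType) := CStarType {
  cstar_mod : completeNormedModType R[i];
  cstar_one : cstar_mod;
  cstar_mul : cstar_mod -> cstar_mod -> cstar_mod;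
  cstar_star : cstar_mod -> cstar_mod;
  cstar_mulA : associative cstar_mul;
  cstar_mul1x : left_id cstar_one cstar_mul;
  cstar_mulx1 : right_id cstar_one cstar_mul;
  cstar_mulDl : left_distributive cstar_mul +%R;
  cstar_mulDr : right_distributive cstar_mul +%R;
  cstar_one_neq0 : cstar_one != 0;
  cstar_scaleAl : forall (c : R[i]) x y,
    c *: cstar_mul x y = cstar_mul (c *: x) y;
  cstar_scaleAr : forall (c : R[i]) x y,
    c *: cstar_mul x y = cstar_mul x (c *: y);
  cstar_starK : involutive cstar_star;
  cstar_starD : {morph cstar_star : x y / x + y};
  cstar_starZ : forall (c : R[i]) x, cstar_star (c *: x) = c^* *: cstar_star x;
  cstar_starM : forall x y,
    cstar_star (cstar_mul x y) = cstar_mul (cstar_star y) (cstar_star x);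
  cstar_normM : forall x y, `|cstar_mul x y| <= `|x| * `|y|;
  cstar_normE : forall x, `|cstar_mul (cstar_star x) x| = `|x| ^+ 2 }.

Definition cstar_sort (R : realType) (A : cstarType R) : Type := cstar_mod A.
Coercion cstar_sort : cstarType >-> Sortclass.

HB.instance Definition _ (R : realType) (A : cstarType R) :=
  CompleteNormedModule.on (cstar_sort A).
HB.instance Definition _ (R : realType) (A : cstarType R) :=
  GRing.Zmodule_isNzRing.Build (cstar_sort A) (@cstar_mulA R A)
    (@cstar_mul1x R A) (@cstar_mulx1 R A) (@cstar_mulDl R A) (@cstar_mulDr R A)
    (@cstar_one_neq0 R A).
HB.instance Definition _ (R : realType) (A : cstarType R) :=
  GRing.Lmodule_isLalgebra.Build R[i] (cstar_sort A) (@cstar_scaleAl R A).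
HB.instance Definition _ (R : realType) (A : cstarType R) :=
  GRing.Lalgebra_isAlgebra.Build R[i] (cstar_sort A) (@cstar_scaleAr R A).

Definition star (R : realType) (A : cstarType R) : A -> A := @cstar_star R A.

Lemma starK (R : realType) (A : cstarType R) : involutive (@star R A).
Proof. exact: cstar_starK. Qed.

Lemma starD (R : realType) (A : cstarType R) :
  {morph @star R A : x y / x + y}.
Proof. exact: cstar_starD. Qed.

Lemma starZ (R : realType) (A : cstarType R) (c : R[i]) (x : A) :
  star (c *: x) = c^* *: star x.
Proof. exact: cstar_starZ. Qed.

Lemma starM (R : realType) (A : cstarType R) (x y : A) :
  star (x * y) = star y * star x.
Proof. exact: cstar_starM. Qed.

Lemma normM_le (R : realType) (A : cstarType R) (x y : A) :
  `|x * y| <= `|x| * `|y|.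
Proof. exact: cstar_normM. Qed.

Lemma norm_starM (R : realType) (A : cstarType R) (x : A) :
  `|star x * x| = `|x| ^+ 2.
Proof. exact: cstar_normE. Qed.

HB.mixin Record isStarMorphism (R : realType) (A B : cstarType R)
    (f : A -> B) := { morph_star : {morph f : x / star x >-> star x} }.

HB.structure Definition StarMorphism (R : realType) (A B : cstarType R) :=
  {f of isStarMorphism R A B f & @GRing.LRMorphism R[i] A B *:%R f}.

Notation "{ 'starmorphism' A '->' B }" := (@StarMorphism.type _ A B)
  (at level 0, A at level 98, B at level 99,
   format "{ 'starmorphism'  A  '->'  B }") : type_scope.

Section MinimalTensorProduct.
Variables (R : realType) (A B : cstarType R).

(** A pair [i : A -> T], [j : B -> T] of *-morphisms with commuting ranges is
    the same thing as a *-morphism from the algebraic tensor product [A (.) B]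
    to [T], sending [a (x) b] to [i a * j b]. *)
Definition commuting_ranges (T : cstarType R)
    (i : {starmorphism A -> T}) (j : {starmorphism B -> T}) :=
  forall a b, i a * j b = j b * i a.

(** Injectivity of that *-morphism on [A (.) B]: every element of [A (.) B] is
    a sum of [a k (x) b k] with the [b k] linearly independent, and it vanishes
    iff all the [a k] do. *)
Definition tensor_injective (T : cstarType R)
    (i : {starmorphism A -> T}) (j : {starmorphism B -> T}) :=
  forall (n : nat) (a : 'I_n -> A) (b : 'I_n -> B),
    (forall c : 'I_n -> R[i],
       \sum_k c k *: b k = 0 -> forall k, c k = 0) ->
    \sum_k i (a k) * j (b k) = 0 -> forall k, a k = 0.

(** [T] is the completion of [A (.) B] for its least C*-norm, with
    [i a = a (x) 1] and [j b = 1 (x) b]: the C*-norms on [A (.) B] are the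
    norms pulled back along the injective *-morphisms from [A (.) B] to
    C*-algebras [T']. *)
Record is_min_tensor (T : cstarType R)
    (i : {starmorphism A -> T}) (j : {starmorphism B -> T}) : Prop := {
  min_tensor_comm : commuting_ranges i j;
  min_tensor_inj : tensor_injective i j;
  min_tensor_dense :
    dense [set x : T | exists (n : nat) (a : 'I_n -> A) (b : 'I_n -> B),
                         x = \sum_k i (a k) * j (b k)];
  min_tensor_least : forall (T' : cstarType R)
      (i' : {starmorphism A -> T'}) (j' : {starmorphism B -> T'}),
    commuting_ranges i' j' -> tensor_injective i' j' ->
    forall (n : nat) (a : 'I_n -> A) (b : 'I_n -> B),
      `|\sum_k i (a k) * j (b k)| <= `|\sum_k i' (a k) * j' (b k)| }.

End MinimalTensorProduct.

(** Coassociativity of [D : A -> T], where [T = A (x) A] through [i] and [j].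
    The algebra [T3] is [(A (x) A) (x) A], with [p x = x (x) 1] and
    [r a = 1 (x) 1 (x) a]; [q] is [x |-> 1 (x) x]; [D1] and [D2] are
    [D (x) id] and [id (x) D], determined by their values on [a (x) 1] and
    [1 (x) a]. *)
Definition coassociative (R : realType) (A T : cstarType R)
    (i j D : {starmorphism A -> T}) : Prop :=
  exists (T3 : cstarType R) (p : {starmorphism T -> T3})
         (r : {starmorphism A -> T3}) (q D1 D2 : {starmorphism T -> T3}),
    [/\ is_min_tensor p r,
        q \o i =1 p \o j /\ q \o j =1 r,
        D1 \o i =1 p \o D /\ D1 \o j =1 r,
        D2 \o i =1 p \o i /\ D2 \o j =1 q \o D
      & D1 \o D =1 D2 \o D].

Record woronowicz (R : realType) := Woronowicz {
  walg :> cstarType R;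
  wtens : cstarType R;
  tensl : {starmorphism walg -> wtens};
  tensr : {starmorphism walg -> wtens};
  wtensP : is_min_tensor tensl tensr;
  comult : {starmorphism walg -> wtens};
  comultA : coassociative tensl tensr comult;
  comult_densel :
    dense [set x : wtens | exists (n : nat) (a b : 'I_n -> walg),
                             x = \sum_k comult (a k) * tensl (b k)];
  comult_denser :
    dense [set x : wtens | exists (n : nat) (a b : 'I_n -> walg),
                             x = \sum_k comult (a k) * tensr (b k)] }.

Arguments tensl {R w}.
Arguments tensr {R w}.
Arguments comult {R w}.

(** [F] is [f (x) f]. *)
Definition woronowicz_isomorphic (R : realType) (V W : woronowicz R) : Prop :=
  exists f : {starmorphism V -> W}, bijective f /\
  exists F : {starmorphism wtens V -> wtens W},
    [/\ F \o tensl =1 tensl \o f, F \o tensr =1 tensr \o f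
      & F \o comult =1 comult \o f].

Section UniversalAlgebras.
Variable R : realType.

(** [A] is the universal C*-algebra generated by the entries of [u] subject to
    the relations [P]. *)
Definition universal (n : nat)
    (P : forall B : cstarType R, 'M[B]_n -> Prop)
    (A : cstarType R) (u : 'M[A]_n) : Prop :=
  P A u /\
  forall (B : cstarType R) (v : 'M[B]_n), P B v ->
    exists f : {starmorphism A -> B},
      map_mx f u = v /\
      forall g : {starmorphism A -> B}, map_mx g u = v -> g =1 f.

Definition orthogonal_mx (n : nat) (A : cstarType R) (u : 'M[A]_n) : Prop :=
  [/\ forall i j, star (u i j) = u i j,
      u *m u^T = 1%:M
    & u^T *m u = 1%:M].

Definition projection (A : cstarType R) (p : A) : Prop :=
  star p = p /\ p * p = p.

Definition magic_unitary (n : nat) (A : cstarType R) (u : 'M[A]_n) : Prop :=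
  [/\ forall i j, projection (u i j),
      forall i j k, j != k -> u i j * u i k = 0,
      forall i j k, j != k -> u j i * u k i = 0,
      forall i, \sum_j u i j = 1
    & forall j, \sum_i u i j = 1].

(** The product over [i < 3] is taken in the order 0, 1, 2. *)
Definition SOm1_relations (A : cstarType R) (a : 'M[A]_3) : Prop :=
  [/\ orthogonal_mx a,
      forall i j k, j != k ->
        a i j * a i k = - (a i k * a i j) /\
        a j i * a k i = - (a k i * a j i),
      forall i j k l, i != k -> j != l -> a i j * a k l = a k l * a i j
    & \sum_(s : 'S_3) \prod_(i < 3) a i (s i) = 1].

Definition matrix_comult (n : nat) (W : woronowicz R) (u : 'M[W]_n) : Prop :=
  forall i j, comult (u i j) = \sum_k tensl (u i k) * tensr (u k j).

Definition is_C_Q4 (W : woronowicz R) (u : 'M[W]_4) : Prop :=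
  universal (@magic_unitary 4) u /\ matrix_comult u.

Definition is_C_SOm1_3 (W : woronowicz R) (a : 'M[W]_3) : Prop :=
  universal SOm1_relations a /\ matrix_comult a.

End UniversalAlgebras.

(* Main.v *)
Require Import Defs.
From HB Require Import structures.
From mathcomp Require Import all_boot all_order all_algebra all_fingroup.
From mathcomp Require Import complex.
From mathcomp Require Import all_classical all_reals all_analysis.
From mathcomp Require Import ring.

(** Index the rows and columns of a 4 x 4 matrix [u] by [K = Z/2 x Z/2] and
    conjugate it by the character table of [K]. Being magic means that the
    coaction [e_l |-> sum_k e_k (x) u k l] on [C(K)] and its transpose are unital
    *-morphisms; in the basis of characters this says that the conjugate of [u]
    is [1 (+) a] with self-adjoint entries and that the rows and columns of
    [1 (+) a] multiply by convolution over [K] as the characters do. These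
    convolution identities are equivalent to the relations of [SO_{-1}(3)]: for
    the nontrivial characters they say that the entries of [a] anticommute,
    commute, and equal their cofactors, minors being permanents; the cofactor
    formula follows in turn from orthogonality and relation (4). The generators
    of the two algebras are thus exchanged by a linear change of variables
    compatible with the comultiplications, and universality makes it an
    isomorphism. *)

Set Implicit Arguments.
Unset Strict Implicit.
Unset Printing Implicit Defensive.

Import Order.TTheory GRing.Theory Num.Theory.
Import numFieldNormedType.Exports.

Local Open Scope classical_set_scope.
Local Open Scope ring_scope.

(** [K] is modelled on ['I_4] by binary digits: [klein_add] is bitwise xor, and
    the sign of [klein_dot i j] is the value at [j] of the [i]-th character. *)
Definition klein_add (i j : 'I_4) : 'I_4 :=
  inZp ((odd i (+) odd j) + (odd i./2 (+) odd j./2).*2)%N.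

Definition klein_dot (i j : 'I_4) : bool :=
  (odd i && odd j) (+) (odd i./2 && odd j./2).

Local Infix "+^" := klein_add (at level 50, left associativity).

Lemma klein_addC : commutative klein_add.
Proof. by do 2![case=> [[|[|[|[|//]]]] ?]]; apply: val_inj. Qed.

Lemma klein_addA : associative klein_add.
Proof. by do 3![case=> [[|[|[|[|//]]]] ?]]; apply: val_inj. Qed.

Lemma klein_add0 : left_id ord0 klein_add.
Proof. by case=> [[|[|[|[|//]]]] ?]; apply: val_inj. Qed.

Lemma klein_addii i : i +^ i = ord0.
Proof. by case: i => [[|[|[|[|//]]]] ?]; apply: val_inj. Qed.

Lemma klein_addK i j : i +^ (i +^ j) = j.
Proof. by rewrite klein_addA klein_addii klein_add0. Qed.

Lemma klein_addr0 : right_id ord0 klein_add.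
Proof. by move=> i; rewrite klein_addC klein_add0. Qed.

Lemma klein_addrK i j : j +^ i +^ i = j.
Proof. by rewrite -klein_addA klein_addii klein_addr0. Qed.

Lemma klein_addCK i j : i +^ j +^ i = j.
Proof. by rewrite klein_addC klein_addK. Qed.

Lemma klein_add_eq0 i j : (i +^ j == ord0) = (i == j).
Proof.
apply/eqP/eqP => [|->]; last exact: klein_addii.
by move=> ij; rewrite -[RHS](klein_addK i) ij klein_addC klein_add0.
Qed.

Lemma klein_add_eqr i j : (i +^ j == j) = (i == ord0).
Proof. by rewrite -klein_add_eq0 -klein_addA klein_addii klein_addr0. Qed.

Lemma klein_dotC : commutative klein_dot.
Proof. by do 2![case=> [[|[|[|[|//]]]] ?]]. Qed.

Lemma klein_dotD i j k : klein_dot i (j +^ k) = klein_dot i j (+) klein_dot i k.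
Proof. by move: i j k; do 3![case=> [[|[|[|[|//]]]] ?]]. Qed.

Lemma reindex_klein (V : nmodType) (i : 'I_4) (f : 'I_4 -> V) :
  \sum_k f k = \sum_k f (i +^ k).
Proof. exact/reindex_inj/(can_inj (klein_addK i)). Qed.

(** Distinct nontrivial [p] and [q] generate the group, so these four elements exhaust it. *)
Lemma sum_klein (V : nmodType) (p q : 'I_4) (f : 'I_4 -> V) :
  p != ord0 -> q != ord0 -> p != q ->
  \sum_k f k = f ord0 + f p + f q + f (p +^ q).
Proof.
move=> p0 q0 pq; rewrite (bigD1 ord0) //= (bigD1 p) //= (bigD1 q) /=; last first.
  by rewrite q0 eq_sym.
rewrite (big_pred1 (p +^ q)) ?addrA // => k /=; move: k p q p0 q0 pq.
by do 3![case=> [[|[|[|[|//]]]] ?]].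
Qed.

(** * Fourier transform on K *)

Section Hadamard.
Variables (F : numFieldType) (A : algType F).
Implicit Types M N : 'M[A]_4.

(** Halving the character table makes it a symmetric involution. *)
Definition hadamard_coef (i j : 'I_4) : F := (-1) ^+ klein_dot i j / 2.
Local Notation h := hadamard_coef.

Definition hadamard : 'M[A]_4 := \matrix_(i, j) (h i j)%:A.

Lemma hadamard_coefC i j : h i j = h j i.
Proof. by rewrite /h klein_dotC. Qed.

Lemma hadamard_coefD i j k : h i j * h i k = h i (j +^ k) / 2.
Proof. by rewrite /h klein_dotD signr_addb mulrACA mulrA. Qed.

Lemma hadamard_coef0 i : h i ord0 = 2^-1.
Proof. by rewrite /h /klein_dot /= !andbF mul1r. Qed.

(** Orthogonality of characters: multiplicativity reduces the sum to that of the single character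
    [i +^ j], computed in each of the four cases. *)
Lemma hadamard_coefK i j : \sum_k h i k * h k j = (i == j)%:R.
Proof.
under eq_bigr => k _ do rewrite [h k j]hadamard_coefC hadamard_coefC
  [h j k]hadamard_coefC hadamard_coefD hadamard_coefC.
rewrite -mulr_suml -klein_add_eq0; move: (i +^ j) => {i j}.
by case=> [[|[|[|[|//]]]] ?]; rewrite !big_ord_recl big_ord0 /h /klein_dot /=;
  field; rewrite ?pnatr_eq0.
Qed.

Lemma hadamardK : hadamard *m hadamard = 1%:M.
Proof.
apply/matrixP=> i j; rewrite !mxE.
under eq_bigr do rewrite !mxE -scalerAl mul1r scalerA.
by rewrite -scaler_suml hadamard_coefK scaler_nat.
Qed.

Definition fourier M := hadamard *m M *m hadamard.

Lemma fourierK : involutive fourier.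
Proof.
move=> M; rewrite /fourier !mulmxA hadamardK mul1mx.
by rewrite -mulmxA hadamardK mulmx1.
Qed.

Lemma fourierE M i j : fourier M i j = \sum_k \sum_l (h i k * h l j) *: M k l.
Proof.
rewrite !mxE exchange_big /=; apply: eq_bigr => k _; rewrite !mxE mulr_suml.
apply: eq_bigr => l _; rewrite !mxE -scalerAr mulr1.
by rewrite -scalerAl mul1r scalerA mulrC.
Qed.

Lemma fourier_tr M : fourier M^T = (fourier M)^T.
Proof.
apply/matrixP=> i j; rewrite [RHS]mxE !fourierE exchange_big.
apply: eq_bigr => l _; apply: eq_bigr => k _.
by rewrite mxE mulrC [h l j]hadamard_coefC [h i k]hadamard_coefC.
Qed.

Definition hat (x : 'I_4 -> A) (i : 'I_4) : A := \sum_k h i k *: x k.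

Lemma eq_hat x y : x =1 y -> hat x =1 hat y.
Proof. by move=> xy i; apply: eq_bigr => k _; rewrite xy. Qed.

Lemma hatZ c x i : hat (fun k => c *: x k) i = c *: hat x i.
Proof.
rewrite /hat scaler_sumr; apply: eq_bigr => k _.
by rewrite !scalerA mulrC.
Qed.

Lemma hatK x : hat (hat x) =1 x.
Proof.
move=> i; rewrite /hat.
under eq_bigr do (rewrite scaler_sumr; under eq_bigr do rewrite scalerA).
rewrite exchange_big (bigD1 i) //= -scaler_suml hadamard_coefK eqxx scale1r.
rewrite big1 ?addr0 // => k ki.
by rewrite -scaler_suml hadamard_coefK eq_sym (negPf ki) scale0r.
Qed.

Lemma hatM x y j l :
  hat x j * hat y l = \sum_k \sum_k' (h j k * h l k') *: (x k * y k').
Proof.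
rewrite mulr_suml; apply: eq_bigr => k _; rewrite mulr_sumr.
by apply: eq_bigr => k' _; rewrite -scalerAl -scalerAr scalerA.
Qed.

Lemma hadamard_coef_split i j k : h i (j +^ k) = 2 * (h i j * h i k).
Proof. by rewrite hadamard_coefD mulrC divfK ?pnatr_eq0. Qed.

Lemma hadamard_coefKD m k l :
  \sum_i h i k * h (m +^ i) l = 2 * h m l *+ (k == l).
Proof.
transitivity (\sum_i 2 * h m l * (h k i * h i l)).
  apply: eq_bigr => i _; rewrite [h (m +^ i) l]hadamard_coefC hadamard_coef_split.
  by rewrite [h m l]hadamard_coefC [h k i]hadamard_coefC
    [h i l]hadamard_coefC; ring.
by rewrite -mulr_sumr hadamard_coefK mulr_natr.
Qed.

(** The convolution theorem; the factor 2 comes from the normalisation of [hadamard_coef]. *)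
Lemma hat_convolution x y m :
  \sum_i hat x i * hat y (m +^ i) = 2 *: hat (fun k => x k * y k) m.
Proof.
under eq_bigr do rewrite hatM.
rewrite exchange_big /hat scaler_sumr; apply: eq_bigr => k _.
rewrite exchange_big scalerA (bigD1 k) //= -scaler_suml hadamard_coefKD eqxx.
rewrite big1 ?addr0 // => l lk.
by rewrite -scaler_suml hadamard_coefKD eq_sym (negPf lk) scale0r.
Qed.

(** The linear map sending the point mass at [l] to [x l] sends the character [j] to [2 *: hat x j];
    its multiplicativity can be tested on either basis. *)
Lemma hat_orthogonal_idempotents x :
  (forall l l', x l * x l' = x l *+ (l == l')) <->
  (forall j j', hat x j * hat x j' = 2^-1 *: hat x (j +^ j')).
Proof.
split=> [xx j j'|xx l l'].
  rewrite hatM scaler_sumr; apply: eq_bigr => k _.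
  rewrite (bigD1 k) //= xx eqxx big1 ?addr0 => [|l lk]; last first.
    by rewrite xx eq_sym (negPf lk) mulr0n scaler0.
  by rewrite scalerA [h j k]hadamard_coefC [h j' k]hadamard_coefC
    hadamard_coefD mulrC hadamard_coefC.
rewrite -[x l]hatK -[x l']hatK hatM.
transitivity (\sum_j \sum_n (h l j * h j l') *: (h l' n *: hat x n)).
  apply: eq_bigr => j _; rewrite (reindex_klein j); apply: eq_bigr => n _.
  rewrite xx klein_addK !scalerA hadamard_coef_split [h j l']hadamard_coefC.
  by congr (_ *: _); field.
rewrite exchange_big /=.
under eq_bigr do rewrite -scaler_suml hadamard_coefK.
rewrite -scaler_sumr -/(hat (hat x) l') !hatK.
by case: eqP => [->|_]; rewrite ?scale1r ?scale0r.
Qed.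

(** The condition concerns columns; for rows it is imposed on [M^T]. *)
Definition convolutive M : Prop :=
  forall m j j', \sum_i M i j * M (m +^ i) j' = M m (j +^ j').

Lemma fourier_hat M i j : fourier M i j = hat (fun k => hat (M k) j) i.
Proof.
rewrite fourierE; apply: eq_bigr => k _; rewrite scaler_sumr.
by apply: eq_bigr => l _; rewrite scalerA [h l j]hadamard_coefC.
Qed.

(** Inverting the transform in the row index turns convolution into an entrywise product for each
    [k]; [hat_orthogonal_idempotents] treats the column index. Columns of the transform thus encode
    rows of [M]. *)
Lemma fourier_convolutive M :
  convolutive (fourier M) <->
  forall k l l', M k l * M k l' = M k l *+ (l == l').
Proof.
split=> [conv k|MM m j j'].
  apply/hat_orthogonal_idempotents => j j'.
  have hatj m : hat (fun k => hat (M k) j * hat (M k) j') m =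
      hat (fun k => 2^-1 *: hat (M k) (j +^ j')) m.
    apply: (can_inj (scalerK (a := 2) _)); rewrite ?pnatr_eq0 //.
    rewrite -hat_convolution; under eq_bigr do rewrite -!fourier_hat.
    by rewrite conv fourier_hat hatZ scalerA divff ?pnatr_eq0 ?scale1r.
  rewrite -[LHS](hatK (fun k => hat (M k) j * hat (M k) j')).
  by rewrite (eq_hat hatj) hatK.
under eq_bigr do rewrite !fourier_hat.
rewrite hat_convolution fourier_hat -hatZ; apply: eq_hat => k.
have /hat_orthogonal_idempotents -> := MM k.
by rewrite scalerA divff ?pnatr_eq0 ?scale1r.
Qed.

(** Column [ord0] is the transform of half the row sums, and the constant 1/2 is the transform of
    the point mass at [ord0]. *)
Lemma fourier_column0 M :
  (forall i, fourier M i ord0 = (i == ord0)%:R) <->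
  (forall k, \sum_l M k l = 1).
Proof.
have hat0 x : \sum_l x l = 2 *: hat x ord0.
  rewrite /hat scaler_sumr; apply: eq_bigr => l _.
  by rewrite hadamard_coefC hadamard_coef0 scalerA divff ?pnatr_eq0 ?scale1r.
have hat_delta k : hat (fun i => (i == ord0)%:R) k = 2^-1%:A.
  rewrite /hat (bigD1 ord0) //= hadamard_coef0 big1 ?addr0 // => i /negPf->.
  by rewrite scaler0.
split=> [M0 k|M1 i].
  rewrite hat0 -[hat (M k) ord0](hatK (fun k => hat (M k) ord0)).
  rewrite (eq_hat (y := fun i => (i == ord0)%:R)) => [|i].
    by rewrite hat_delta scalerA divff ?pnatr_eq0 ?scale1r.
  by rewrite -M0 fourier_hat.
rewrite -[RHS](hatK (fun i => (i == ord0)%:R)) fourier_hat; apply: eq_hat => k.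
apply: (can_inj (scalerK (a := 2) _)); rewrite ?pnatr_eq0 //.
by rewrite -hat0 M1 hat_delta scalerA divff ?pnatr_eq0 ?scale1r.
Qed.

End Hadamard.

(** * Convolution identities and cofactors *)

Section Klein.
Variables (F : numFieldType) (A : algType F).
Implicit Type M : 'M[A]_4.

Lemma eqN_eq0 (x : A) : x = - x -> x = 0.
Proof.
move=> xN; apply: (can_inj (scalerK (a := 2 : F) _)); rewrite ?pnatr_eq0 //.
by rewrite scaler0 scaler_nat mulr2n {2}xN subrr.
Qed.

Lemma convolutive_trE M : convolutive M^T <->
  forall m p q, \sum_j M p j * M q (m +^ j) = M (p +^ q) m.
Proof.
by split=> MM m p q; have := MM m p q; rewrite ?mxE => <-; apply: eq_bigr => j _;
  rewrite ?mxE.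
Qed.

Definition unit_bordered M : Prop :=
  (forall j, M ord0 j = (j == ord0)%:R) /\ (forall i, M i ord0 = (i == ord0)%:R).

Definition klein_commuting M : Prop :=
  forall i j k l, i != k -> j != l -> M i j * M k l = M k l * M i j.

Definition klein_anticommuting M : Prop :=
  forall i j k, j != k -> j != ord0 -> k != ord0 ->
    M i j * M i k = - (M i k * M i j).

Definition orthonormal_rows M : Prop :=
  forall i j, \sum_k M i k * M j k = (i == j)%:R.

(** For nontrivial rows of a unit-bordered matrix, a term survives only if [n], [j], [n +^ j] are
    the three nontrivial elements in some order: this is the permanent of the rows [r], [p], [q]. *)
Definition cubic M (r p q : 'I_4) : A :=
  \sum_n M r n * \sum_j M p j * M q (n +^ j).

(** The row [ord0] is a unit for convolution. If [p] equals [q], the terms at [j] and [m +^ j]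
    cancel by anticommutation, except for trivial [m], where orthonormality applies. *)
Lemma convolutive_degenerate M (m p q : 'I_4) :
  unit_bordered M -> klein_anticommuting M -> orthonormal_rows M ->
  [|| p == ord0, q == ord0 | p == q] ->
  \sum_j M p j * M q (m +^ j) = M (p +^ q) m.
Proof.
move=> [M0l M0r] anti orth /or3P[] /eqP->.
- rewrite klein_add0 (bigD1 ord0) //= M0l mul1r klein_addC klein_add0.
  by rewrite big1 ?addr0 // => j /negPf j0; rewrite M0l j0 mul0r.
- rewrite klein_addC klein_add0 (bigD1 m) //= M0l klein_addii mulr1.
  rewrite big1 ?addr0 // => j jm; rewrite M0l klein_add_eq0 eq_sym (negPf jm).
  by rewrite mulr0.
rewrite klein_addii M0l; have [->|m0] := eqVneq m ord0.
  by under eq_bigr do rewrite klein_add0; rewrite orth eqxx.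
apply: eqN_eq0; rewrite [LHS](reindex_klein m) -sumrN; apply: eq_bigr => j _.
rewrite klein_addK; have [->|q0] := eqVneq q ord0.
  rewrite !M0l klein_add_eq0; have [->|_] := eqVneq j ord0.
    by rewrite (negPf m0) mulr0 mul0r oppr0.
  by rewrite mulr0 mul0r oppr0.
have [->|j0] := eqVneq j ord0; first by rewrite M0r (negPf q0) mulr0 mul0r oppr0.
have [->|mj] := eqVneq m j; first by
  rewrite klein_addii M0r (negPf q0) mulr0 mul0r oppr0.
by rewrite anti // ?klein_add_eqr ?klein_add_eq0.
Qed.

(** For nontrivial [n] the columns [j] and [n +^ j] differ, so the two inner entries commute;
    reindexing by [n] then exchanges their columns. *)
Lemma cubicC23 M (r p q : 'I_4) : unit_bordered M -> klein_commuting M ->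
  r != ord0 -> p != q -> cubic M r p q = cubic M r q p.
Proof.
move=> [_ M0r] comm r0 pq; apply: eq_bigr => n _.
have [->|n0] := eqVneq n ord0; first by rewrite M0r (negPf r0) !mul0r.
congr (_ * _); rewrite [RHS](reindex_klein n); apply: eq_bigr => j _.
rewrite klein_addK comm //; apply: contra_neq n0 => jn.
by rewrite -[n](klein_addK j) [j +^ n]klein_addC -jn klein_addii.
Qed.

Lemma cubicC12 M (r p q : 'I_4) : unit_bordered M -> klein_commuting M ->
  q != ord0 -> r != p -> cubic M r p q = cubic M p r q.
Proof.
move=> [_ M0r] comm q0 rp; rewrite /cubic.
under eq_bigr do rewrite mulr_sumr.
rewrite exchange_big; apply: eq_bigr => j _; rewrite mulr_sumr.
apply: eq_bigr => n _; rewrite !mulrA klein_addC.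
have [->|jn] := eqVneq j n; last by rewrite comm // eq_sym.
by rewrite klein_addii M0r (negPf q0) !mulr0.
Qed.

(** Exchanging [n] and [j] changes the sign by anticommutation in row [p]; the terms with [n = j]
    vanish because their last factor lies in column [ord0]. *)
Lemma cubic_diag M (p q : 'I_4) : unit_bordered M -> klein_anticommuting M ->
  p != ord0 -> q != ord0 -> cubic M p p q = 0.
Proof.
move=> [_ M0r] anti p0 q0; apply: eqN_eq0; rewrite {1}/cubic.
under eq_bigr do rewrite mulr_sumr.
rewrite exchange_big -sumrN; apply: eq_bigr => j _.
rewrite mulr_sumr -sumrN.
apply: eq_bigr => n _; rewrite !mulrA -mulNr klein_addC.
have [->|j0] := eqVneq j ord0; first by
  rewrite M0r (negPf p0) !(mulr0, mul0r, oppr0).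
have [->|n0] := eqVneq n ord0; first by
  rewrite M0r (negPf p0) !(mulr0, mul0r, oppr0).
have [->|jn] := eqVneq j n; last by rewrite anti // eq_sym.
by rewrite klein_addii M0r (negPf q0) !mulr0.
Qed.

Lemma cubic_klein_add M (p q : 'I_4) : unit_bordered M -> klein_commuting M ->
  cubic M (inZp 1) (inZp 2) (inZp 3) = 1 ->
  p != ord0 -> q != ord0 -> p != q -> cubic M (p +^ q) p q = 1.
Proof.
move=> ub comm M123; have C12 := cubicC12 ub comm; have C23 := cubicC23 ub comm.
have M132 : cubic M (inZp 1) (inZp 3) (inZp 2) = 1 by rewrite C23.
have M213 : cubic M (inZp 2) (inZp 1) (inZp 3) = 1 by rewrite C12.
have M231 : cubic M (inZp 2) (inZp 3) (inZp 1) = 1 by rewrite C23.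
have M312 : cubic M (inZp 3) (inZp 1) (inZp 2) = 1 by rewrite C12.
have M321 : cubic M (inZp 3) (inZp 2) (inZp 1) = 1 by rewrite C23.
move: p q => [[|[|[|[|//]]]] ?] [[|[|[|[|//]]]] ?] //= _ _ _;
  solve [ by apply: etrans M123; congr cubic; apply: val_inj
        | by apply: etrans M132; congr cubic; apply: val_inj
        | by apply: etrans M213; congr cubic; apply: val_inj
        | by apply: etrans M231; congr cubic; apply: val_inj
        | by apply: etrans M312; congr cubic; apply: val_inj
        | by apply: etrans M321; congr cubic; apply: val_inj ].
Qed.

Lemma klein_rows_convolution M : unit_bordered M -> klein_commuting M ->
  klein_anticommuting M -> orthonormal_rows M -> orthonormal_rows M^T ->
  cubic M (inZp 1) (inZp 2) (inZp 3) = 1 -> convolutive M^T.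
Proof.
move=> ub comm anti orthr orthc M123; apply/convolutive_trE => m p q.
have [|] := boolP [|| p == ord0, q == ord0 | p == q].
  exact: convolutive_degenerate.
rewrite !negb_or => /and3P[p0 q0 pq].
(* [C] is the row [p + q] of the cofactor matrix, in which minors are
   permanents. Expansion along rows gives [M C = e_(p + q)], so [C] is the row
   [p + q] of [M] by orthogonality. *)
pose C n := \sum_j M p j * M q (n +^ j); rewrite -/(C m).
have MC r : \sum_n M r n * C n = (r == p +^ q)%:R.
  have [->|rpq] := eqVneq r (p +^ q); first exact: cubic_klein_add.
  (* Against the unit row the sum is [C ord0], the inner product of the rows [p] and [q]. *)
  have [->|r0] := eqVneq r ord0.
    rewrite (bigD1 ord0) //= ub.1 mul1r big1 ?addr0 => [|n n0]; last first.
      by rewrite ub.1 (negPf n0) mul0r.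
    rewrite /C; under eq_bigr do rewrite klein_add0.
    by rewrite orthr (negPf pq).
  have: [|| r == p | r == q].
    by move: r p q rpq r0 p0 q0 pq {C}; do 3![case=> [[|[|[|[|//]]]] ?]].
  case/orP=> /eqP->; first exact: cubic_diag.
  by rewrite -[LHS]/(cubic M q p q) cubicC23 // cubic_diag.
have orthcE n n' : \sum_r M r n * M r n' = (n == n')%:R.
  by rewrite -orthc; apply: eq_bigr => r _; rewrite !mxE.
(* Column orthonormality inserts an identity matrix in front of [C], so that [MC] applies. *)
transitivity (\sum_n \sum_r M r m * M r n * C n).
  rewrite (bigD1 m) //= -mulr_suml orthcE eqxx mul1r big1 ?addr0 // => n nm.
  by rewrite -mulr_suml orthcE eq_sym (negPf nm) mul0r.
rewrite exchange_big /=.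
under eq_bigr => r _ do under eq_bigr => n _ do rewrite -mulrA.
under eq_bigr => r _ do rewrite -mulr_sumr MC.
rewrite (bigD1 (p +^ q)) //= eqxx mulr1 big1 ?addr0 // => r /negPf->.
by rewrite mulr0.
Qed.

(** In the nondegenerate case, the column convolution and the expansion of [M m (j +^ k)] as a
    convolution of the rows [p] and [m +^ p] have two surviving terms each, which agree after one
    commutation. *)
Lemma klein_columns_convolution M : unit_bordered M -> klein_commuting M ->
  klein_anticommuting M^T -> orthonormal_rows M^T ->
  convolutive M^T -> convolutive M.
Proof.
move=> ub comm anti orth rows; have /convolutive_trE rowsE := rows.
rewrite -[M]trmxK; apply/convolutive_trE => m j k.
have [|] := boolP [|| j == ord0, k == ord0 | j == k].
  apply: convolutive_degenerate => //.
  by split=> i; rewrite mxE ?ub.1 ?ub.2.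
rewrite !negb_or => /and3P[j0 k0 jk].
have [->|m0] := eqVneq m ord0.
  under eq_bigr do rewrite klein_add0.
  by rewrite orth (negPf jk) mxE ub.1 klein_add_eq0 (negPf jk).
(* Any nontrivial row other than [m] serves, since [p +^ (m +^ p)] is [m]. *)
have [p p0 pm] : exists2 p : 'I_4, p != ord0 & p != m.
  exists (if m == inZp 1 then inZp 2 else inZp 1); first by case: ifP.
  by case: ifP => [/eqP->|/negbT]; rewrite // eq_sym.
have mp_m : m +^ p != m by rewrite klein_addC klein_add_eqr.
rewrite (sum_klein _ m0 p0) 1?eq_sym // !mxE klein_addK klein_addii.
rewrite !ub.1 (negPf j0) (negPf k0) mul0r mulr0 !add0r.
rewrite (_ : M m (j +^ k) = M (p +^ (m +^ p)) (j +^ k)); last first.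
  by rewrite [m +^ p]klein_addC klein_addK.
rewrite -[RHS]rowsE (sum_klein _ j0 k0 jk) !ub.2 (negPf p0) klein_addii ub.2.
rewrite klein_add_eq0 eq_sym (negPf pm) mul0r mulr0 add0r addr0.
rewrite klein_addCK klein_addrK; congr (_ + _).
by rewrite comm // klein_add_eqr.
Qed.

Lemma convolutive_orthonormal_rows M : unit_bordered M -> convolutive M^T ->
  orthonormal_rows M.
Proof.
move=> ub /convolutive_trE rows i j; rewrite -klein_add_eq0 -ub.2 -rows.
by apply: eq_bigr => k _; rewrite klein_add0.
Qed.

(** A nontrivial row [i] convolved with itself gives row [ord0], which vanishes at [j +^ k]; the
    surviving terms of the convolution form the anticommutator. *)
Lemma convolutive_anticommuting M : unit_bordered M -> convolutive M^T ->
  klein_anticommuting M.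
Proof.
move=> ub /convolutive_trE rows i j k jk j0 k0; apply/eqP; rewrite -addr_eq0.
have [->|i0] := eqVneq i ord0.
  by rewrite !ub.1 (negPf j0) (negPf k0) !mul0r addr0.
have := rows (j +^ k) i i; rewrite klein_addii ub.1 klein_add_eq0 (negPf jk).
rewrite (sum_klein _ j0 k0 jk) klein_addii !ub.2 (negPf i0) mul0r mulr0 add0r.
by rewrite addr0 klein_addCK klein_addrK => ->.
Qed.

(** [M (i +^ k) (j +^ l)] is both a row and a column convolution, with two surviving terms each;
    cancelling the common term [M k j * M i l] leaves the commutation. *)
Lemma convolutive_commuting M : unit_bordered M ->
  convolutive M -> convolutive M^T -> klein_commuting M.
Proof.
move=> ub cols /convolutive_trE rows i j k l ik jl.
have [->|i0] := eqVneq i ord0; first by rewrite ub.1 commr_nat.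
have [->|k0] := eqVneq k ord0; first by rewrite ub.1 commr_nat.
have [->|j0] := eqVneq j ord0; first by rewrite ub.2 commr_nat.
have [->|l0] := eqVneq l ord0; first by rewrite ub.2 commr_nat.
have := rows (j +^ l) k i; rewrite [k +^ i]klein_addC -cols.
rewrite (sum_klein _ j0 l0 jl) (sum_klein _ i0 k0 ik) !klein_addii.
rewrite !ub.1 !ub.2 (negPf j0) (negPf k0) (negPf i0) (negPf l0).
rewrite !(mul0r, mulr0) !(add0r, addr0).
rewrite !klein_addCK !klein_addrK addrC => /addIr.
by move->.
Qed.

Lemma convolutive_cubic M p q : unit_bordered M -> convolutive M^T ->
  cubic M (p +^ q) p q = 1.
Proof.
move=> ub rows; have orth := convolutive_orthonormal_rows ub rows.
move/convolutive_trE: rows => rows; rewrite /cubic.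
under eq_bigr do rewrite rows.
by rewrite orth eqxx.
Qed.

End Klein.

(** * Relations of the two algebras *)

Lemma star0 (R : realType) (A : cstarType R) : star (0 : A) = 0.
Proof. by apply: (addrI (star 0)); rewrite -starD !addr0. Qed.

(** * Noncommutative permanents and bordered matrices *)

Lemma reindex_lift_perm (V : nmodType) n (i0 j0 : 'I_n.+1)
    (f : 'S_n.+1 -> V) :
  \sum_(s : 'S_n.+1 | s i0 == j0) f s = \sum_(t : 'S_n) f (lift_perm i0 j0 t).
Proof.
rewrite (reindex (lift_perm i0 j0)).
  by apply: eq_bigl => t; rewrite lift_perm_id eqxx.
(* Deleting [i0] and its image from [s] inverts [lift_perm]; injectivity of [s] keeps the default
   [k] from being returned. *)
pose g (s : 'S_n.+1) k := odflt k (unlift (s i0) (s (lift i0 k))).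
have gE (s : 'S_n.+1) k : lift (s i0) (g s k) = s (lift i0 k).
  rewrite /g; have := neq_lift i0 k.
  by rewrite -(inj_eq (@perm_inj _ s)) => /unlift_some[k' -> ->].
have g_inj s : injective (g s).
  move=> k l kl; apply: (@lift_inj _ i0); apply: (@perm_inj _ s).
  by rewrite -!gE kl.
exists (fun s => perm (g_inj s)) => [t _|s /eqP si0].
  apply/permP => k; apply: (@lift_inj _ (lift_perm i0 j0 t i0)).
  by rewrite [X in lift _ X = _]permE gE lift_perm_id lift_perm_lift.
apply/permP => k; case: (unliftP i0 k) => [l|] ->; last by rewrite lift_perm_id.
by rewrite lift_perm_lift -si0 permE gE.
Qed.

Lemma permanent_expand_row0 (A : nzRingType) n (a : 'I_n.+1 -> 'I_n.+1 -> A) :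
  \sum_(s : 'S_n.+1) \prod_i a i (s i) =
  \sum_j a ord0 j * \sum_(t : 'S_n) \prod_i a (lift ord0 i) (lift j (t i)).
Proof.
rewrite (partition_big (fun s : 'S_n.+1 => s ord0) predT) //=.
apply: eq_bigr => j _.
rewrite (reindex_lift_perm _ _ (fun s => \prod_i a i (s i))).
rewrite mulr_sumr; apply: eq_bigr => t _; rewrite big_ord_recl lift_perm_id.
by congr (_ * _); apply: eq_bigr => i _; rewrite lift_perm_lift.
Qed.

Section Bordered.
Variables (A : nzRingType) (a : 'M[A]_3).

Definition bordered : 'M[A]_4 := lift0_mx a.

Lemma bordered_lift i j : bordered (lift ord0 i) (lift ord0 j) = a i j.
Proof. by rewrite -!rshift1; exact: block_mxEdr. Qed.

Lemma bordered0l j : bordered ord0 j = (j == ord0)%:R.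
Proof.
rewrite /bordered /lift0_mx.
rewrite (_ : @ord0 3 = lshift 3 (@ord0 0)); last exact: val_inj.
case: (unliftP (lshift 3 (@ord0 0) : 'I_4) j) => [k|] ->.
  rewrite -[lift _ _]rshift1.
  by apply: etrans (block_mxEur _ _ _ _ _ _) _; rewrite mxE.
by apply: etrans (block_mxEul _ _ _ _ _ _) _; rewrite mxE eqxx.
Qed.

Lemma bordered0r i : bordered i ord0 = (i == ord0)%:R.
Proof.
rewrite /bordered /lift0_mx.
rewrite (_ : @ord0 3 = lshift 3 (@ord0 0)); last exact: val_inj.
case: (unliftP (lshift 3 (@ord0 0) : 'I_4) i) => [k|] ->.
  rewrite -[lift _ _]rshift1.
  by apply: etrans (block_mxEdl _ _ _ _ _ _) _; rewrite mxE.
by apply: etrans (block_mxEul _ _ _ _ _ _) _; rewrite mxE eqxx.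
Qed.

End Bordered.

(** Three row expansions yield six monomials, matching the terms of [cubic] that avoid the
    border. *)
Lemma cubic_bordered (F : numFieldType) (A : algType F) (a : 'M[A]_3) :
  cubic (bordered a) (inZp 1) (inZp 2) (inZp 3) =
  \sum_(s : 'S_3) \prod_(i < 3) a i (s i).
Proof.
rewrite (permanent_expand_row0 a).
under eq_bigr => n _.
  rewrite (permanent_expand_row0 (fun i k => a (lift ord0 i) (lift n k))).
  under eq_bigr => j _.
    rewrite (permanent_expand_row0
      (fun i k => a (lift ord0 (lift ord0 i)) (lift n (lift j k)))).
    under eq_bigr => k _.
      rewrite (eq_bigr (fun=> 1)); last by move=> t _; rewrite big_ord0.
      rewrite sumr_const card_Sn mulr1.
      over.
    over.
  over.
rewrite /cubic !big_ord_recl !big_ord0 /=.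
rewrite !klein_addii !klein_addr0 !(bordered0l, bordered0r) /=.
rewrite !(mul0r, mulr0, add0r, addr0).
by congr (_ * (_ * _ + _ * _) + (_ * (_ * _ + _ * _) + _ * (_ * _ + _ * _)));
  rewrite -bordered_lift; congr (fun_of_matrix _ _ _); apply: val_inj.
Qed.

Lemma bordered_unit (F : numFieldType) (A : algType F) (a : 'M[A]_3) :
  unit_bordered (bordered a).
Proof. by split; [exact: bordered0l | exact: bordered0r]. Qed.

Lemma bordered_tr (A : nzRingType) (a : 'M[A]_3) : (bordered a)^T = bordered a^T.
Proof.
apply/matrixP=> i j; rewrite mxE.
case: (unliftP ord0 j) => [j'|] ->; last by rewrite bordered0l bordered0r.
case: (unliftP ord0 i) => [i'|] ->; last by rewrite bordered0l bordered0r.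
by rewrite !bordered_lift mxE.
Qed.

Lemma bordered_commuting (F : numFieldType) (A : algType F) (a : 'M[A]_3) :
  (forall i j k l, i != k -> j != l -> a i j * a k l = a k l * a i j) <->
  klein_commuting (bordered a).
Proof.
split=> comm i j k l ik jl; last first.
  by rewrite -!bordered_lift comm // (inj_eq lift_inj).
case: (unliftP ord0 i) ik => [i' ->|->] ik; last by rewrite bordered0l commr_nat.
case: (unliftP ord0 k) ik => [k' ->|->] ik; last by rewrite bordered0l commr_nat.
case: (unliftP ord0 j) jl => [j' ->|->] jl; last by rewrite bordered0r commr_nat.
case: (unliftP ord0 l) jl => [l' ->|->] jl; last by rewrite bordered0r commr_nat.
by rewrite !bordered_lift comm // -(inj_eq (@lift_inj _ ord0)).
Qed.

Lemma bordered_anticommuting (F : numFieldType) (A : algType F) (a : 'M[A]_3) :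
  (forall i j k, j != k -> a i j * a i k = - (a i k * a i j)) <->
  klein_anticommuting (bordered a).
Proof.
split=> [anti i j k jk j0 k0|anti i j k jk]; last first.
  by rewrite -!bordered_lift anti ?(inj_eq lift_inj).
case: (unliftP ord0 i) => [i'|] ->; last first.
  by rewrite !bordered0l (negPf j0) (negPf k0) !mul0r oppr0.
case: (unliftP ord0 j) jk j0 => [j' ->|->] jk //.
case: (unliftP ord0 k) jk k0 => [k' ->|->] jk //.
by rewrite !bordered_lift anti // -(inj_eq (@lift_inj _ ord0)).
Qed.

Lemma bordered_orthonormal (F : numFieldType) (A : algType F) (a : 'M[A]_3) :
  a *m a^T = 1%:M <-> orthonormal_rows (bordered a).
Proof.
have E i j : \sum_k bordered a (lift ord0 i) k * bordered a (lift ord0 j) k =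
    (a *m a^T) i j.
  rewrite big_ord_recl !bordered0r mul0r add0r mxE.
  by apply: eq_bigr => k _; rewrite !bordered_lift mxE.
split=> [aa i j|orth]; last first.
  by apply/matrixP=> i j; rewrite -E orth (inj_eq lift_inj) [RHS]mxE.
case: (unliftP ord0 i) => [i'|] ->; last first.
  rewrite big_ord_recl big1 ?addr0 => [|k _]; last by rewrite bordered0l mul0r.
  by rewrite bordered0l mul1r bordered0r eq_sym.
case: (unliftP ord0 j) => [j'|] ->; last first.
  rewrite big_ord_recl big1 ?addr0 => [|k _]; last by rewrite bordered0l mulr0.
  by rewrite bordered0r mul0r.
by rewrite E aa mxE (inj_eq lift_inj).
Qed.

Lemma SOm1_bordered (R : realType) (A : cstarType R) (a : 'M[A]_3) :
  SOm1_relations a <->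
  [/\ forall i j, star (a i j) = a i j, convolutive (bordered a)
    & convolutive (bordered a)^T].
Proof.
have ub := bordered_unit a; have ubT := bordered_unit a^T.
split=> [[[aS aaT aTa] anti comm perm]|[aS cols rows]].
  have antiM : klein_anticommuting (bordered a).
    by apply/bordered_anticommuting => i j k /(anti i)[].
  have antiMT : klein_anticommuting (bordered a)^T.
    rewrite bordered_tr; apply/bordered_anticommuting => i j k /(anti i)[_].
    by rewrite !mxE.
  have commM : klein_commuting (bordered a) by exact/bordered_commuting.
  have orthM : orthonormal_rows (bordered a) by exact/bordered_orthonormal.
  have orthMT : orthonormal_rows (bordered a)^T.
    by rewrite bordered_tr; apply/bordered_orthonormal; rewrite trmxK.
  have rows : convolutive (bordered a)^T.
    by apply: klein_rows_convolution => //; rewrite cubic_bordered.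
  by split=> //; exact: klein_columns_convolution.
(* With this, the lemmas about rows also apply to [a^T]. *)
have colsT : convolutive (bordered a^T)^T by rewrite bordered_tr trmxK.
split.
- split=> //; first exact/bordered_orthonormal/convolutive_orthonormal_rows.
  rewrite -{2}[a]trmxK.
  exact/bordered_orthonormal/convolutive_orthonormal_rows.
- have anti := convolutive_anticommuting ub rows.
  have antiT := convolutive_anticommuting ubT colsT.
  move=> i j k jk; split; first by move/bordered_anticommuting: anti; exact.
  by move/bordered_anticommuting/(_ i j k jk): antiT; rewrite !mxE.
- exact/bordered_commuting/convolutive_commuting.
(* In the group 1 = 2 + 3, so the three rows have the form [p +^ q], [p], [q]. *)
rewrite -cubic_bordered (_ : inZp 1 = inZp 2 +^ inZp 3); last exact: val_inj.
exact: convolutive_cubic.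
Qed.

Lemma star_fourier (R : realType) (A : cstarType R) (u : 'M[A]_4) :
  (forall i j, star (u i j) = u i j) ->
  forall i j, star (fourier u i j) = fourier u i j.
Proof.
move=> uS i j; rewrite fourierE (big_morph _ (@starD _ A) (star0 A)).
apply: eq_bigr => k _; rewrite (big_morph _ (@starD _ A) (star0 A)).
apply: eq_bigr => l _; rewrite starZ uS; congr (_ *: _).
by rewrite /hadamard_coef !rmorphM /= !rmorph_sign fmorphV /= conjC_nat.
Qed.

(** Row relations of [u] become column relations of the transform; the other half follows by
    transposition, with which [fourier] commutes. Self-adjointness passes both ways as [fourier] is
    an involution with real coefficients. *)
Lemma magic_fourier (R : realType) (A : cstarType R) (u : 'M[A]_4) :
  magic_unitary u <->
  [/\ forall i j, star (fourier u i j) = fourier u i j,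
      unit_bordered (fourier u),
      convolutive (fourier u) & convolutive (fourier u)^T].
Proof.
split=> [[uP rows cols rows1 cols1]|[MS [M0l M0r] /fourier_convolutive rows]].
  split.
  - by apply: star_fourier => i j; case: (uP i j).
  - split=> [j|]; last exact/fourier_column0.
    have: forall k, \sum_l u^T k l = 1.
      by move=> k; rewrite -(cols1 k); apply: eq_bigr => l _; rewrite mxE.
    by move/fourier_column0/(_ j); rewrite fourier_tr mxE.
  - apply/fourier_convolutive => k l l'.
    by have [->|ll] := eqVneq l l'; [case: (uP k l') | rewrite rows].
  rewrite -fourier_tr; apply/fourier_convolutive => k l l'; rewrite !mxE.
  by have [->|ll] := eqVneq l l'; [case: (uP l' k) | rewrite cols].
rewrite -fourier_tr => /fourier_convolutive cols; split.
- move=> i j; split; last by rewrite rows eqxx.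
  by rewrite -[u]fourierK; exact: star_fourier.
- by move=> i j k jk; rewrite rows (negPf jk).
- by move=> i j k jk; have := cols i j k; rewrite !mxE (negPf jk).
- exact/fourier_column0.
move=> j; have: forall i, fourier u^T i ord0 = (i == ord0)%:R.
  by move=> i; rewrite fourier_tr mxE.
move/fourier_column0/(_ j) <-; by apply: eq_bigr => i _; rewrite mxE.
Qed.

(** * Extension of *-morphisms by density *)

(** The C*-identity and submultiplicativity bound the norm of [y] by that of [star y]; applying this
    to [star x] too gives equality. *)
Lemma norm_star (R : realType) (A : cstarType R) (x : A) : `|star x| = `|x|.
Proof.
have le_star (y : A) : `|y| <= `|star y|.
  have [->|y0] := eqVneq y 0; first by rewrite normr0.
  rewrite -(ler_pM2r (x := `|y|)) ?normr_gt0 // -expr2 -norm_starM.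
  exact: normM_le.
by apply/eqP; rewrite eq_le le_star -{2}[x]starK le_star.
Qed.

Lemma starB (R : realType) (A : cstarType R) : {morph @star R A : x y / x - y}.
Proof. by move=> x y; rewrite starD -scaleN1r starZ rmorphN1 scaleN1r. Qed.

Lemma star_continuous (R : realType) (A : cstarType R) : continuous (@star R A).
Proof.
move=> x; apply/cvgrPdist_lt => /= e e0; near=> y.
rewrite -starB norm_star; near: y.
exact: cvgr_dist_lt.
Unshelve. all: by end_near. Qed.

Lemma cstar_mul_continuous (R : realType) (A : cstarType R) :
  continuous (fun z : A * A => z.1 * z.2).
Proof.
move=> [x y] /=; apply/cvgrPdist_lt => /= e e0.
(* Since [z.2] has norm at most that of [y] plus 1, this [d] bounds the error by [e / 2], which
   leaves room for strictness. *)
pose d := e / 2 / (`|x| + `|y| + 1).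
have c0 : 0 < `|x| + `|y| + 1 by rewrite ltr_wpDl ?addr_ge0.
have d0 : 0 < d by rewrite !divr_gt0.
have nx r : 0 < r -> \forall z \near (x, y), `|x - z.1| < r.
  by apply: (@cvgr_dist_lt _ A _ (nbhs (x, y)) _ fst x); exact: cvg_fst.
have ny r : 0 < r -> \forall z \near (x, y), `|y - z.2| < r.
  by apply: (@cvgr_dist_lt _ A _ (nbhs (x, y)) _ snd y); exact: cvg_snd.
near=> z.
have xz : `|x - z.1| < d by near: z; exact: nx.
have yz : `|y - z.2| < d by near: z; exact: ny.
have yz1 : `|y - z.2| < 1 by near: z; exact: ny.
have z2 : `|z.2| <= `|y| + 1.
  rewrite -[z.2](subKr y) (le_trans (ler_normB _ _)) // lerD2l; exact: ltW.
have -> : x * y - z.1 * z.2 = x * (y - z.2) + (x - z.1) * z.2.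
  by rewrite mulrBr mulrBl addrA subrK.
apply: (le_lt_trans (ler_normD _ _)); apply: (@le_lt_trans _ _ (e / 2)).
  apply: (@le_trans _ _ (`|x| * d + d * (`|y| + 1))).
    apply: lerD; apply: (le_trans (normM_le _ _));
      by apply: ler_pM => //; exact: ltW.
  by rewrite [d * _]mulrC -mulrDl addrA /d mulrC divfK // gt_eqF.
by rewrite ltr_pdivrMr // ltr_pMr // (ltr_nat _ 1 2).
Unshelve. all: by end_near. Qed.

Lemma closure_op2 (X Y : topologicalType) (f : X * X -> X) (g : Y * Y -> Y)
    (S : set (X * Y)) :
  continuous f -> continuous g ->
  (forall s t, S s -> S t -> S (f (s.1, t.1), g (s.2, t.2))) ->
  forall s t, closure S s -> closure S t ->
    closure S (f (s.1, t.1), g (s.2, t.2)).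
Proof.
move=> fc gc SS s t Ss St B [[/= U V] [fU gV] UV].
have [[/= U1 U2] [sU tU] fUU] := fc _ _ fU.
have [[/= V1 V2] [sV tV] gVV] := gc _ _ gV.
have [|s' [Ss' [/= sU' sV']]] := Ss (U1 `*` V1); first by exists (U1, V1).
have [|t' [St' [/= tU' tV']]] := St (U2 `*` V2); first by exists (U2, V2).
exists (f (s'.1, t'.1), g (s'.2, t'.2)); split; first exact: SS.
by apply: UV; split; [exact: (fUU (s'.1, t'.1)) | exact: (gVV (s'.2, t'.2))].
Qed.

Lemma closure_op1 (X Y : topologicalType) (f : X -> X) (g : Y -> Y)
    (S : set (X * Y)) :
  continuous f -> continuous g -> (forall s, S s -> S (f s.1, g s.2)) ->
  forall s, closure S s -> closure S (f s.1, g s.2).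
Proof.
move=> fc gc SS s Ss B [[/= U V] [/fc fU /gc gV] UV].
have [|s' [Ss' [/= sU sV]]] := Ss ((f @^-1` U) `*` (g @^-1` V)).
  by exists (f @^-1` U, g @^-1` V).
by exists (f s'.1, g s'.2); split; [exact: SS | exact: UV].
Qed.

Lemma starmorphismP (R : realType) (A B : cstarType R) (f : A -> B) :
  nmod_morphism f -> monoid_morphism f -> scalable f ->
  {morph f : x / star x >-> star x} ->
  exists F : {starmorphism A -> B}, F =1 f.
Proof.
move=> fD fM fZ fS.
pose mD := GRing.isNmodMorphism.Build A B f fD.
pose mM := GRing.isMonoidMorphism.Build A B f fM.
pose mZ := GRing.isScalable.Build R[i] A B *:%R f fZ.
pose mS := isStarMorphism.Build R A B f fS.
pose F : {starmorphism A -> B} := HB.pack f mD mM mZ mS.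
by exists F.
Qed.

(** [closure S] is the graph of the extension. *)
Section ExtendStarMorphism.
Variables (R : realType) (T T' : cstarType R) (S : set (T * T')).

Hypothesis S1 : S (1, 1).
Hypothesis SD : forall s t, S s -> S t -> S (s.1 + t.1, s.2 + t.2).
Hypothesis SM : forall s t, S s -> S t -> S (s.1 * t.1, s.2 * t.2).
Hypothesis SZ : forall (c : R[i]) s, S s -> S (c *: s.1, c *: s.2).
Hypothesis Sstar : forall s, S s -> S (star s.1, star s.2).
Hypothesis Sle : forall s, S s -> `|s.2| <= `|s.1|.
Hypothesis Sdense : dense [set s.1 | s in S].

Lemma graph_closureD s t : closure S s -> closure S t ->
  closure S (s.1 + t.1, s.2 + t.2).
Proof. exact: (closure_op2 (@add_continuous T) (@add_continuous T')). Qed.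

Lemma graph_closureM s t : closure S s -> closure S t ->
  closure S (s.1 * t.1, s.2 * t.2).
Proof.
exact: (closure_op2 (@cstar_mul_continuous _ T) (@cstar_mul_continuous _ T')).
Qed.

Lemma graph_closureZ (c : R[i]) s : closure S s -> closure S (c *: s.1, c *: s.2).
Proof.
apply: (@closure_op1 T T' ( *:%R c) ( *:%R c)) => [||t]; last exact: SZ.
- exact: scaler_continuous.
- exact: scaler_continuous.
Qed.

Lemma graph_closure_star s : closure S s -> closure S (star s.1, star s.2).
Proof.
exact: (closure_op1 (@star_continuous _ T) (@star_continuous _ T')).
Qed.

(** By [Sle], a pair of [S] close to [(0, y)] has a small second component, so [y] is arbitrarily
    small. *)
Lemma graph_closure0 y : closure S (0, y) -> y = 0.
Proof.
move=> Sy; apply/eqP/negPn/negP => y0.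
have e0 : 0 < `|y| / 2 by rewrite divr_gt0 ?normr_gt0.
pose U := ball (0 : T) (`|y| / 2); pose V := ball y (`|y| / 2).
have [|[s t] [/= Sst [/= s0 ty]]] := Sy (U `*` V).
  by exists (U, V) => //; split; exact: nbhsx_ballx.
move: s0 ty; rewrite /U /V -!ball_normE /ball_ /= sub0r normrN => s0 ty.
suff: `|y| < `|y| by rewrite ltxx.
rewrite -{1}[y](subrK t) [ltRHS]splitr (le_lt_trans (ler_normD _ _)) //.
rewrite ltrD //; exact: le_lt_trans (Sle Sst) s0.
Qed.

Lemma graph_closure_fun x y y' : closure S (x, y) -> closure S (x, y') -> y = y'.
Proof.
move=> xy /(graph_closureZ (c := -1))/(graph_closureD xy) /=.
by rewrite !scaleN1r subrr => /graph_closure0/eqP; rewrite subr_eq0 => /eqP.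
Qed.

Lemma graph_closure_total x : exists y, closure S (x, y).
Proof.
(* [Phi] is the trace on [S] of the neighbourhoods of [x]: density makes it proper, and [Sle]
   applied to differences makes its second projection Cauchy. *)
pose Phi := filter_from (nbhs x) (fun B : set T => [set s | S s /\ B s.1]).
have Phi_filter : ProperFilter Phi.
  apply: filter_from_proper.
    apply: filter_from_filter; first by exists setT; exact: filterT.
    move=> B B' xB xB'; exists (B `&` B'); first exact: filterI.
    by move=> s [Ss []].
  move=> B; rewrite nbhsE; case=> O [oO Ox] OB.
  have [|z [/OB Bz [s Ss sz]]] := Sdense _ oO; first by exists x.
  by exists s; split => //; rewrite sz.
have Phi_cauchy : cauchy (snd @ Phi).
  apply: cauchy_exP => e e0.
  have e20 : 0 < e / 2 by rewrite divr_gt0.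
  have near_x : Phi [set s | S s /\ `|x - s.1| < e / 2].
    exists (ball x (e / 2)); first exact: nbhsx_ballx.
    by move=> s [Ss]; rewrite -ball_normE.
  have [s [Ss xs]] := filter_ex near_x.
  exists s.2; apply: filterS near_x => t [St xt]; rewrite -ball_normE /ball_ /=.
  have := Sle (SD Ss (SZ (-1) St)); rewrite /= !scaleN1r => /le_lt_trans; apply.
  rewrite -(subrK x s.1) -addrA (le_lt_trans (ler_normD _ _)) // [e]splitr.
  by rewrite ltrD // distrC.
have [y Phiy] : exists y : T', snd @ Phi --> y.
  by exists (lim (snd @ Phi)); exact: cauchy_cvg Phi_cauchy.
exists y => B [[/= U V] [xU yV] UV].
have PU : Phi [set s | S s /\ U s.1] by exists U.
have [s [[Ss Us] Vs]] := filter_ex (filterI PU (Phiy _ yV)).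
by exists s; split => //; exact: UV.
Qed.

Lemma extend_starmorphism :
  exists F : {starmorphism T -> T'}, forall s, S s -> F s.1 = s.2.
Proof.
have [f fP] := choice graph_closure_total.
have fE x y : closure S (x, y) -> f x = y by exact: graph_closure_fun.
have SC s : S s -> closure S s by exact: subset_closure.
have [F FE] : exists F : {starmorphism T -> T'}, F =1 f.
  apply: starmorphismP.
  - split=> [|x y]; last exact/fE/(graph_closureD (fP x) (fP y)).
    by apply: fE; have := graph_closureZ (c := 0) (fP 0); rewrite !scale0r.
  - split=> [|x y]; first exact/fE/SC.
    exact/fE/(graph_closureM (fP x) (fP y)).
  - by move=> c x; exact/fE/(graph_closureZ (fP x)).
  - by move=> x; exact/fE/(graph_closure_star (fP x)).
by exists F; case=> x y Sxy; rewrite FE; exact/fE/SC.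
Qed.

End ExtendStarMorphism.

(** * The isomorphism *)

Section StarComposition.
Variables (R : realType) (A B C : cstarType R).
Variables (g : {starmorphism B -> C}) (f : {starmorphism A -> B}).

Lemma comp_morph_star : {morph g \o f : x / star x >-> star x}.
Proof. by move=> x /=; rewrite !morph_star. Qed.

HB.instance Definition _ :=
  isStarMorphism.Build R A C (g \o f) comp_morph_star.

End StarComposition.

HB.instance Definition _ (R : realType) (A : cstarType R) :=
  isStarMorphism.Build R A A idfun (fun=> erefl).

(** * Functoriality of the minimal tensor product *)

Section TensorSum.
Variables (R : realType) (A B T : cstarType R).
Variables (i : {starmorphism A -> T}) (j : {starmorphism B -> T}).
Implicit Types s : seq (A * B).

(** With lists of pairs, concatenation and pairwise products represent the sum and product of
    algebraic tensors. *)
Definition tensor_sum s : T := \sum_(p <- s) i p.1 * j p.2.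

Lemma tensor_sum_tnth s :
  tensor_sum s =
  \sum_k i (tnth (in_tuple s) k).1 * j (tnth (in_tuple s) k).2.
Proof. exact: big_tnth. Qed.

Lemma tensor_sum1 : tensor_sum [:: (1, 1)] = 1.
Proof. by rewrite /tensor_sum big_seq1 !rmorph1 mulr1. Qed.

Lemma tensor_sum_cat s s' : tensor_sum (s ++ s') = tensor_sum s + tensor_sum s'.
Proof. exact: big_cat. Qed.

Lemma tensor_sumZ (c : R[i]) s :
  tensor_sum [seq (c *: p.1, p.2) | p <- s] = c *: tensor_sum s.
Proof.
rewrite /tensor_sum big_map scaler_sumr; apply: eq_bigr => p _.
by rewrite linearZZ scalerAl.
Qed.

Hypothesis ijC : commuting_ranges i j.

Lemma tensor_sumM s s' :
  tensor_sum [seq (p.1 * q.1, p.2 * q.2) | p <- s, q <- s'] =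
  tensor_sum s * tensor_sum s'.
Proof.
rewrite /tensor_sum big_allpairs_dep /= mulr_suml.
apply: eq_bigr => p _; rewrite mulr_sumr; apply: eq_bigr => q _.
by rewrite !rmorphM !mulrA; congr (_ * _); rewrite -!mulrA ijC.
Qed.

Lemma tensor_sum_star s :
  tensor_sum [seq (star p.1, star p.2) | p <- s] = star (tensor_sum s).
Proof.
rewrite /tensor_sum big_map (big_morph _ (@starD _ T) (star0 T)).
by apply: eq_bigr => p _; rewrite starM -!morph_star ijC.
Qed.

End TensorSum.

(** Through [f] and [g], each of [T] and [T'] carries a C*-norm on the algebraic
    tensor square of [B]; minimality of the norm of [T'] makes the algebraic
    map contractive. *)
Lemma min_tensor_map (R : realType) (A B T T' : cstarType R)
    (i j : {starmorphism A -> T}) (i' j' : {starmorphism B -> T'})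
    (f : {starmorphism A -> B}) (g : {starmorphism B -> A}) :
  is_min_tensor i j -> is_min_tensor i' j' -> cancel f g -> cancel g f ->
  exists F : {starmorphism T -> T'}, F \o i =1 i' \o f /\ F \o j =1 j' \o f.
Proof.
move=> [ijC ij_inj ij_dense _] [ijC' _ _ ij_least] fK gK.
pose t := tensor_sum i j.
pose t' := tensor_sum (i' \o f) (j' \o f).
have fijC : commuting_ranges (i' \o f) (j' \o f) by move=> a b; exact: ijC'.
have gijC : commuting_ranges (i \o g) (j \o g) by move=> a b; exact: ijC.
(* Being linear and injective, [g] preserves linear independence. *)
have gij_inj : tensor_injective (i \o g) (j \o g).
  move=> n a b free ab0 k; apply: (can_inj gK); rewrite raddf0.
  apply: (ij_inj n (g \o a) (g \o b)) => // c cb; apply: free.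
  apply: (can_inj gK); rewrite raddf0 raddf_sum -[RHS]cb.
  by apply: eq_bigr => l _; rewrite /= linearZZ.
have t'_le s : `|t' s| <= `|t s|.
  rewrite /t /t' !tensor_sum_tnth.
  rewrite (le_trans (ij_least T _ _ gijC gij_inj _ _ _)) //=.
  by under eq_bigr do rewrite !fK.
(* A relation suffices here: the bound [t'_le] makes it single-valued. *)
pose S := [set z : T * T' | exists s, z = (t s, t' s)].
have [|||||||F FE] := @extend_starmorphism R T T' S.
- by exists [:: (1, 1)]; rewrite /t /t' !tensor_sum1.
- move=> _ _ [s ->] [s' ->]; exists (s ++ s').
  by rewrite /t /t' !tensor_sum_cat.
- move=> _ _ [s ->] [s' ->].
  exists [seq (p.1 * q.1, p.2 * q.2) | p <- s, q <- s'].
  by rewrite /t /t' !tensor_sumM.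
- move=> c _ [s ->]; exists [seq (c *: p.1, p.2) | p <- s].
  by rewrite /t /t' !tensor_sumZ.
- move=> _ [s ->]; exists [seq (star p.1, star p.2) | p <- s].
  by rewrite /t /t' !tensor_sum_star.
- by move=> _ [s ->]; exact: t'_le.
- move=> O O0 oO; have [x [Ox [n [a [b xE]]]]] := ij_dense O O0 oO.
  exists x; split=> //; pose s := [seq (a k, b k) | k <- enum 'I_n].
  exists (t s, t' s); first by exists s.
  by rewrite /= /t /tensor_sum big_map big_enum -xE.
exists F; split=> a /=.
  have := FE (i a, i' (f a)); rewrite /=; apply; exists [:: (a, 1)].
  by rewrite /t /t' /tensor_sum !big_seq1 /= !rmorph1 !mulr1.
have := FE (j a, j' (f a)); rewrite /=; apply; exists [:: (1, a)].
by rewrite /t /t' /tensor_sum !big_seq1 /= !rmorph1 !mul1r.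
Qed.

(** Both morphisms are the one that universality attaches to the common image of the generators. *)
Lemma universal_inj (R : realType) n
    (P : forall B : cstarType R, 'M[B]_n -> Prop) (A B : cstarType R)
    (u : 'M[A]_n) (f g : {starmorphism A -> B}) :
  universal P u -> P B (map_mx f u) -> map_mx f u = map_mx g u -> f =1 g.
Proof.
move=> [_ univ] Pfu fgu x; have [h [_ hE]] := univ B _ Pfu.
by rewrite (hE f) // (hE g).
Qed.

Lemma magic_unitary_map (R : realType) (A B : cstarType R)
    (f : {starmorphism A -> B}) (u : 'M[A]_4) :
  magic_unitary u -> magic_unitary (map_mx f u).
Proof.
move=> [uP rows cols rows1 cols1]; split=> [i j|i j k jk|i j k jk|i|j].
- by rewrite mxE /projection -morph_star -rmorphM; case: (uP i j) => -> ->.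
- by rewrite !mxE -rmorphM rows // rmorph0.
- by rewrite !mxE -rmorphM cols // rmorph0.
- by under eq_bigr do rewrite mxE; rewrite -rmorph_sum rows1 rmorph1.
- by under eq_bigr do rewrite mxE; rewrite -rmorph_sum cols1 rmorph1.
Qed.

Lemma map_fourier (R : realType) (A B : cstarType R)
    (f : {starmorphism A -> B}) (u : 'M[A]_4) :
  map_mx f (fourier u) = fourier (map_mx f u).
Proof.
apply/matrixP=> i j; rewrite mxE !fourierE raddf_sum.
apply: eq_bigr => k _; rewrite raddf_sum; apply: eq_bigr => l _.
by rewrite /= linearZZ mxE.
Qed.

Lemma map_bordered (R : realType) (A B : cstarType R)
    (f : {starmorphism A -> B}) (a : 'M[A]_3) :
  map_mx f (bordered a) = bordered (map_mx f a).
Proof.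
apply/matrixP=> i j; rewrite mxE.
case: (unliftP ord0 i) => [i'|] ->; last by rewrite !bordered0l rmorph_nat.
case: (unliftP ord0 j) => [j'|] ->; last by rewrite !bordered0r rmorph_nat.
by rewrite !bordered_lift mxE.
Qed.

Lemma star_bordered (R : realType) (A : cstarType R) (a : 'M[A]_3) :
  (forall i j, star (a i j) = a i j) ->
  forall i j, star (bordered a i j) = bordered a i j.
Proof.
move=> aS i j.
have star_bool (c : bool) : star (c%:R : A) = c%:R.
  case: c; last exact: star0.
  by rewrite -[LHS]mul1r -{1}[1]starK -starM mul1r starK.
case: (unliftP ord0 i) => [i'|] ->; last by rewrite bordered0l.
case: (unliftP ord0 j) => [j'|] ->; last by rewrite bordered0r.
by rewrite bordered_lift.
Qed.

Lemma bordered_inj (A : nzRingType) : injective (@bordered A).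
Proof.
by move=> a b ab; apply/matrixP=> i j; rewrite -!bordered_lift ab.
Qed.

Lemma borderedM (A : nzRingType) (a b : 'M[A]_3) :
  bordered (a *m b) = bordered a *m bordered b.
Proof.
apply/matrixP=> i j; rewrite [RHS]mxE big_ord_recl.
case: (unliftP ord0 i) => [i'|] ->; last first.
  rewrite !bordered0l mul1r big1 ?addr0 // => k _.
  by rewrite bordered0l mul0r.
rewrite [bordered a _ ord0]bordered0r mul0r add0r.
case: (unliftP ord0 j) => [j'|] ->; last first.
  by rewrite bordered0r big1 // => k _; rewrite bordered0r mulr0.
by rewrite bordered_lift mxE; apply: eq_bigr => k _; rewrite !bordered_lift.
Qed.

Lemma unit_bordered_ex (F : numFieldType) (A : algType F) (M : 'M[A]_4) :
  unit_bordered M -> exists a, M = bordered a.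
Proof.
move=> [M0l M0r]; exists (\matrix_(i, j) M (lift ord0 i) (lift ord0 j)).
apply/matrixP=> i j.
case: (unliftP ord0 i) => [i'|] ->; last by rewrite M0l bordered0l.
case: (unliftP ord0 j) => [j'|] ->; last by rewrite M0r bordered0r.
by rewrite bordered_lift mxE.
Qed.

(** The inner copies of [hadamard] cancel, so the change of variables respects the matrix product
    defining the comultiplications. *)
Lemma fourierM (F : numFieldType) (A : algType F) (M N : 'M[A]_4) :
  fourier (M *m N) = fourier M *m fourier N.
Proof.
rewrite /fourier !mulmxA; congr (_ *m _ *m _).
by rewrite -(mulmxA _ (hadamard A)) hadamardK mulmx1.
Qed.

Lemma matrix_comultE (R : realType) n (W : woronowicz R) (u : 'M[W]_n) :
  matrix_comult u <->
  map_mx comult u = map_mx tensl u *m map_mx tensr u.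
Proof.
split=> [uD|/matrixP uD i j]; last first.
  by have := uD i j; rewrite !mxE => ->; apply: eq_bigr => k _; rewrite !mxE.
apply/matrixP=> i j; rewrite !mxE uD.
by apply: eq_bigr => k _; rewrite !mxE.
Qed.

Theorem theorem3p1 (R : realType) (V W : woronowicz R)
    (u : 'M[V]_4) (a : 'M[W]_3) :
  is_C_Q4 u -> is_C_SOm1_3 a -> woronowicz_isomorphic V W.
Proof.
move=> [u_univ /matrix_comultE uD] [a_univ /matrix_comultE aD].
have /magic_fourier[uS u_unit u_cols u_rows] := u_univ.1.
(* [b] is the block of nontrivial characters in the transform of [u]; it provides the images of the
   generators [a]. *)
have [b bE] := unit_bordered_ex u_unit.
have SO_b : SOm1_relations b.
  apply/SOm1_bordered; rewrite -bE; split=> // i j.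
  by rewrite -bordered_lift -bE uS.
have /SOm1_bordered[aS a_cols a_rows] := a_univ.1.
have magic_a : magic_unitary (fourier (bordered a)).
  apply/magic_fourier; rewrite fourierK; split=> //; last exact: bordered_unit.
  exact: star_bordered.
have [f [fu _]] := u_univ.2 W _ magic_a.
have [g [ga _]] := a_univ.2 V _ SO_b.
have fb : map_mx f b = a.
  by apply: bordered_inj; rewrite -map_bordered -bE map_fourier fu fourierK.
have fK : cancel f g.
  apply: (universal_inj (f := g \o f) (g := idfun) u_univ).
    exact/magic_unitary_map/u_univ.1.
  by rewrite map_mx_comp fu map_fourier map_bordered ga -bE fourierK map_mx_id.
have gK : cancel g f.
  have fga : map_mx (f \o g) a = a by rewrite map_mx_comp ga fb.
  apply: (universal_inj (f := f \o g) (g := idfun) a_univ).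
    by rewrite fga; exact: a_univ.1.
  by rewrite fga map_mx_id.
have [F [Fl Fr]] := min_tensor_map (wtensP V) (wtensP W) fK gK.
exists f; split; first by exists g.
exists F; split=> //.
(* It suffices to compare both sides on [u], where each comultiplication is a matrix product,
   preserved by [bordered] and [fourier]. *)
apply: (universal_inj (f := F \o comult) (g := comult \o f) u_univ).
  exact/magic_unitary_map/u_univ.1.
have Fu (t : {starmorphism V -> wtens V}) (t' : {starmorphism W -> wtens W}) :
    F \o t =1 t' \o f -> map_mx F (map_mx t u) = map_mx t' (map_mx f u).
  by move=> Ft; apply/matrixP=> i j; rewrite !mxE; exact: Ft.
rewrite map_mx_comp uD map_mxM (Fu _ _ Fl) (Fu _ _ Fr) [RHS]map_mx_comp fu.
by rewrite !map_fourier !map_bordered aD borderedM fourierM.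
Qed.
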